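(* $\mathrm{PC} \not\sim \mathrm{UC}$: there is a sequence $(F_n)_{n \in \mathbb{N}}$ of clause-sets in $\mathrm{UC}$ with $n(F_n) = n$, computable in time $n^{O(1)}$, such that there is no sequence $(F'_n)_{n\in\mathbb{N}}$ of clause-sets in $\mathrm{PC}$ with $F'_n$ equivalent to $F_n$ for all $n$ and $\ell(F'_n) = n^{O(1)}$.
   Context: Literals are variables $v$ and complements $\overline{v}$; a clause is a finite set of literals without complementary pair; a clause-set is a finite set of clauses; $\bot$ is the empty clause, $\top$ the empty clause-set. $n(F)$ is the number of variables of $F$, $\ell(F)=\sum_{C\in F}|C|$, $\mathrm{lit}(F)$ the set of literals over $\mathrm{var}(F)$. A partial assignment $\varphi$ (finite set of variables to $\{0,1\}$) applied to $F$, written $\varphi*F$, removes clauses containing a literal set to $1$ and removes literals set to $0$ from remaining clauses; $\langle x \to \varepsilon\rangle$ sets literal $x$ to $\varepsilon$. $F$ is satisfiable iff $\varphi*F=\top$ for some $\varphi$. Two clause-sets are equivalent iff they have the same satisfying assignments (equivalently, the same prime implicates). Unit-clause propagation $r_1$: $r_1(F) = \{\bot\}$ if $\bot \in F$; else if $F$ contains a unit clause $\{x\}$, $r_1(F) = r_1(\langle x\to 1\rangle * F)$; else $r_1(F)=F$. A literal $x$ is forced for $F$ iff $\langle x\to 0\rangle*F$ is unsatisfiable. $\mathrm{UC}$ is the class of clause-sets $F$ such that for every partial assignment $\varphi$ with $\varphi*F$ unsatisfiable, $r_1(\varphi*F)=\{\bot\}$. $\mathrm{PC}$ is the class of clause-sets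 $F$ such that for every partial assignment $\varphi$ the clause-set $G := r_1(\varphi*F)$ has no forced literal $x$ with $x \in \mathrm{lit}(G)$. *)

(* Defs.v *)
From HB Require Import structures.
From mathcomp Require Import all_boot finmap.

Set Implicit Arguments.
Unset Strict Implicit.
Unset Printing Implicit Defensive.

Local Open Scope fset_scope.
Local Open Scope fmap_scope.

(** * Clause-sets *)

(* The infinite supply of variables is the set of bit strings: a machine writes
   a variable as the string that it is, so no numbering has to be fixed. *)
Definition var : Type := seq bool.

(* (v, true) is the literal v and (v, false) is its complement. *)
Definition literal : Type := (var * bool)%type.

(* Complementary pairs are excluded by is_clause, not by the type. *)
Definition clause : Type := {fset literal}.
Definition cnf : Type := {fset clause}.

Definition compl (x : literal) : literal := (x.1, ~~ x.2).

Definition is_clause (C : clause) : bool :=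
  all (fun x => compl x \notin C) C.

Definition is_clauseset (F : cnf) : bool :=
  all is_clause F.

Definition bot : clause := fset0.
Definition top : cnf := fset0.

Definition occ (F : cnf) : {fset literal} :=
  [fset x | C in F, x in C].

Definition vars (F : cnf) : {fset var} :=
  [fset x.1 | x in occ F].

Definition nvar (F : cnf) : nat := #|` vars F|.

Definition ell (F : cnf) : nat := \sum_(C <- F) #|` C|.

(** * Partial assignments *)

Definition passign : Type := {fmap var -> bool}.

Definition lit_val (phi : passign) (x : literal) : option bool :=
  omap (fun e => e == x.2) phi.[? x.1].

Definition sat_clause (phi : passign) (C : clause) : bool :=
  has (fun x => lit_val phi x == Some true) C.

Definition apply_clause (phi : passign) (C : clause) : clause :=
  [fset x in C | lit_val phi x != Some false].

Definition apply (phi : passign) (F : cnf) : cnf :=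
  [fset apply_clause phi C | C in F & ~~ sat_clause phi C].

Definition set_lit (x : literal) (e : bool) : passign :=
  [fmap].[x.1 <- e == x.2].

Definition satisfiable (F : cnf) : Prop :=
  exists phi : passign, apply phi F = top.

(* A satisfying assignment is a partial assignment phi with apply phi F = top.
   As clauses have no complementary pair, comparing only the total ones would
   give the same relation. *)
Definition equivalent (F G : cnf) : Prop :=
  forall phi : passign, apply phi F = top <-> apply phi G = top.

Definition forced (F : cnf) (x : literal) : Prop :=
  ~ satisfiable (apply (set_lit x false) F).

(** * Unit-clause propagation *)

Definition unit_lit (F : cnf) : option (occ F) :=
  [pick x : occ F | [fset val x] \in F].

(* Each step removes a variable, so nvar F steps suffice; lemma r1E below is
   the recursion that defines r1. *)
Fixpoint r1_rec (k : nat) (F : cnf) : cnf :=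
  if k is k'.+1 then
    if bot \in F then [fset bot]
    else if unit_lit F is Some x then r1_rec k' (apply (set_lit (val x) true) F)
    else F
  else F.

Definition r1 (F : cnf) : cnf :=
  r1_rec (nvar F) F.

Lemma occP (F : cnf) (x : literal) :
  reflect (exists2 C, C \in F & x \in C) (x \in occ F).
Proof.
apply: (iffP idP) => [/imfset2P [C /= CF [y /= yC ->]]|[C CF xC]].
  by exists C.
by apply/imfset2P; exists C => //; exists x.
Qed.

Lemma nvar_set_lit (F : cnf) (x : literal) (e : bool) :
  x \in occ F -> nvar (apply (set_lit x e) F) < nvar F.
Proof.
move=> xoF; have xF : x.1 \in vars F by apply/imfsetP; exists x.
rewrite /nvar (cardfsD1 x.1 (vars F)) xF add1n ltnS.
apply/fsubset_leq_card/fsubsetP=> v; rewrite !inE.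
case/imfsetP=> y /= /occP[D /imfsetP[C /=]].
rewrite !inE => /andP[CF Cns] -> + ->; rewrite !inE => /andP[yC yv].
apply/andP; split; last by apply/imfsetP; exists y => //=; apply/occP; exists C.
apply/eqP=> xy; case/negP: Cns; apply/hasP; exists y => //.
move: yv; rewrite /lit_val /set_lit xy fnd_set eqxx /=.
by case: (_ == y.2).
Qed.

Lemma r1_rec_nvar (k : nat) (F : cnf) :
  nvar F <= k -> r1_rec k F = r1 F.
Proof.
rewrite /r1; elim: k {-2}k (leqnn k) F => [|m IH] k.
  by rewrite leqn0 => /eqP-> F; rewrite leqn0 => /eqP->.
move=> km F Fk; case: (posnP (nvar F)) => [F0|].
  rewrite F0; case: k {Fk} km => // k _ /=.
  have noc y : y \notin occ F.
    apply/negP=> yF; move/eqP: F0; rewrite cardfs_eq0 => /eqP F0.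
    by have: y.1 \in vars F; [apply/imfsetP; exists y | rewrite F0 inE].
  have FE C : C \in F -> C = bot.
    move=> CF; apply/fsetP=> y; rewrite inE; apply/negbTE/negP=> yC.
    by case/negP: (noc y); apply/occP; exists C.
  rewrite /unit_lit; case: pickP => [x|_].
    by case/negP: (noc (val x)); exact: valP.
  case: ifP => // bF; apply/fsetP=> C; rewrite inE; apply/eqP/idP=> [->//|].
  exact: FE.
case FE: (nvar F) => [//|j] _; case: k km Fk => [|k] km; rewrite FE // => Fk /=.
case: ifP => // _; case: (unit_lit F) => // x.
have lt := nvar_set_lit true (valP x); rewrite FE ltnS in lt.
rewrite (IH k) // ?(IH j) //; first exact: leq_trans Fk km.
exact: leq_trans lt Fk.
Qed.

Lemma r1E (F : cnf) : r1 F =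
  if bot \in F then [fset bot]
  else if unit_lit F is Some x then r1 (apply (set_lit (val x) true) F)
  else F.
Proof.
rewrite -(@r1_rec_nvar (nvar F).+1) //=; case: ifP => // _.
case: (unit_lit F) => // x; apply: r1_rec_nvar.
exact/ltnW/nvar_set_lit/valP.
Qed.

(** * The classes UC and PC *)

Definition UC (F : cnf) : Prop :=
  is_clauseset F /\
  forall phi : passign,
    ~ satisfiable (apply phi F) -> r1 (apply phi F) = [fset bot].

(* x.1 \in vars G says that x is in lit(G). *)
Definition PC (F : cnf) : Prop :=
  is_clauseset F /\
  forall (phi : passign) (x : literal),
    x.1 \in vars (r1 (apply phi F)) -> ~ forced (r1 (apply phi F)) x.

(** * Polynomial time *)

(* f(n) = n^O(1) *)
Definition poly_bounded (f : nat -> nat) : Prop :=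
  exists k N : nat, forall n, N <= n -> f n <= n ^ k.

Variant move : Type := MoveL | Stay | MoveR.

(* Deterministic Turing machines with finitely many one-way infinite tapes;
   the tape symbols are 0, 1 and the blank, None. *)
Record tm : Type := TM {
  tm_last : nat;
  tm_state : finType;
  tm_start : tm_state;
  tm_halt : pred tm_state;
  tm_delta : tm_state -> {ffun 'I_tm_last.+1 -> option bool} ->
    tm_state * ('I_tm_last.+1 -> option bool * move)
}.

Record config (M : tm) : Type := Config {
  cf_state : tm_state M;
  cf_tape : 'I_(tm_last M).+1 -> nat -> option bool;
  cf_head : 'I_(tm_last M).+1 -> nat
}.

(* A head at the left end of its tape stays there under MoveL. *)
Definition move_head (d : move) (p : nat) : nat :=
  match d with MoveL => p.-1 | Stay => p | MoveR => p.+1 end.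

Definition tm_step (M : tm) (c : config M) : config M :=
  if tm_halt (cf_state c) then c else
  let: (q, act) :=
    tm_delta (cf_state c) [ffun i => cf_tape c i (cf_head c i)] in
  Config q
    (fun i p => if p == cf_head c i then (act i).1 else cf_tape c i p)
    (fun i => move_head (act i).2 (cf_head c i)).

(* The input is on the first tape, all the other tapes are blank. *)
Definition tm_init (M : tm) (w : seq bool) : config M :=
  Config (tm_start M)
    (fun i => if i == ord0 then onth w else fun=> None)
    (fun=> 0).

(* The output is the contents of the last tape. *)
Definition tm_outputs (M : tm) (w : seq bool) (t : nat) (u : seq bool) : Prop :=
  let c := iter t (@tm_step M) (tm_init M w) in
  tm_halt (cf_state c) /\ cf_tape c ord_max =1 onth u.

(* Self-delimiting: each item is preceded by 1, the end is marked by 0. *)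
Definition enc_seq (A : Type) (enc : A -> seq bool) (s : seq A) : seq bool :=
  rcons (flatten [seq true :: enc x | x <- s]) false.

Definition enc_var (v : var) : seq bool := enc_seq (fun b => [:: b]) v.

Definition enc_literal (x : literal) : seq bool := x.2 :: enc_var x.1.

Definition enc_cnf (s : seq (seq literal)) : seq bool :=
  enc_seq (enc_seq enc_literal) s.

Definition listing (s : seq (seq literal)) (F : cnf) : Prop :=
  F = seq_fset tt [seq seq_fset tt c | c <- s].

(* The input n is given in unary, so that polynomial time is time n^O(1). *)
Definition poly_time (F : nat -> cnf) : Prop :=
  exists (M : tm) (T : nat -> nat),
    poly_bounded T /\
    forall n, exists2 s, listing s (F n) &
      tm_outputs M (nseq n true) (T n) (enc_cnf s).

(* Main.v *)
Require Import Defs.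
From mathcomp Require Import all_boot finmap zify.

(* The clauses [u_i /\ p_i -> u_{i+1}], [u_i /\ r_i -> u_{i+1}] (i < m) and
   [~ (u_0 /\ u_m)] form a Horn clause-set, and Horn clause-sets are in UC. Set
   one of p_i, r_i to true for every i < m. Then ~ u_0 is the only literal that
   follows, so in an equivalent clause-set in PC some clause must become the
   unit clause {~ u_0}. As no choice can be dropped, this clause consists of
   ~ u_0 and of the negations of all the chosen variables. So there is a
   different clause for each of the 2^m choices.

   The names are u_i = 1^i, p_i = 1^i 01 and r_i = 1^i 00. The clauses have a
   fixed shape up to the prefix 1^i, so a machine prints them with a single
   counter i. *)

Set Implicit Arguments.
Unset Strict Implicit.
Unset Printing Implicit Defensive.

Local Open Scope fset_scope.
Local Open Scope fmap_scope.

(** * Total assignments *)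

Definition satc (a : var -> bool) (C : clause) : bool :=
  has (fun x => a x.1 == x.2) C.

Definition model (a : var -> bool) (F : cnf) : bool := all (satc a) F.

Definition agrees (a : var -> bool) (phi : passign) : Prop :=
  forall v b, phi.[? v] = Some b -> a v = b.

Definition override (a : var -> bool) (phi : passign) : var -> bool :=
  fun v => odflt (a v) phi.[? v].

Definition restr (D : {fset var}) (a : var -> bool) : passign :=
  [fmap v : D => a (val v)].

Lemma fnd_restr (D : {fset var}) a v :
  (restr D a).[? v] = if v \in D then Some (a v) else None.
Proof.
case: ifPn => [vD|vD]; last by rewrite not_fnd.
by rewrite in_fnd ffunE.
Qed.

Lemma override_agrees a phi : agrees (override a phi) phi.
Proof. by move=> v b E; rewrite /override E. Qed.

Lemma mem_applyP (phi : passign) (F : cnf) (C : clause) :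
  reflect (exists2 D, (D \in F) && ~~ sat_clause phi D & C = apply_clause phi D)
    (C \in apply phi F).
Proof.
apply: (iffP (imfsetP _ _ _ _)) => -[D /= DF ->]; exists D => //; move: DF;
  by rewrite !inE.
Qed.

Lemma mem_apply_clause (phi : passign) (C : clause) x :
  (x \in apply_clause phi C) = (x \in C) && (lit_val phi x != Some false).
Proof. by rewrite !inE. Qed.

Lemma apply_topP (phi : passign) (F : cnf) :
  apply phi F = top <-> all (sat_clause phi) F.
Proof.
split=> [E|/allP sF].
  apply/allP=> C CF; apply/negPn/negP=> nC.
  have: apply_clause phi C \in apply phi F.
    by apply/mem_applyP; exists C => //; rewrite CF.
  by rewrite E inE.
apply/fsetP=> C; rewrite inE; apply/mem_applyP=> -[D /andP[DF]].
by rewrite sF.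
Qed.

Lemma sat_clause_agrees a phi C :
  agrees a phi -> sat_clause phi C -> satc a C.
Proof.
move=> ag /hasP[x xC /eqP]; rewrite /lit_val; case E: phi.[? x.1] => [b|] //=.
by case=> bx; apply/hasP; exists x => //; rewrite (ag _ _ E) bx.
Qed.

Lemma apply_clause_unset phi C x :
  ~~ sat_clause phi C -> x \in apply_clause phi C -> phi.[? x.1] = None.
Proof.
move=> /hasPn nC; rewrite mem_apply_clause => /andP[xC].
by move: (nC _ xC); rewrite /lit_val; case: phi.[? x.1] => //= b; case: (b == x.2).
Qed.

Lemma satc_apply_clause a phi C :
  agrees a phi -> satc a (apply_clause phi C) = satc a C.
Proof.
move=> ag; apply/hasP/hasP => -[x xC ax]; exists x => //; move: xC;
  rewrite mem_apply_clause; first by case/andP.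
move=> ->; rewrite /lit_val; case E: phi.[? x.1] => [b|] //=.
by rewrite -(ag _ _ E) ax.
Qed.

Lemma model_apply a phi F : agrees a phi -> model a (apply phi F) = model a F.
Proof.
move=> ag; apply/allP/allP => [mF C CF|mF C /mem_applyP[D /andP[DF nD] ->]].
  have [sC|nC] := boolP (sat_clause phi C); first exact: sat_clause_agrees sC.
  rewrite -(satc_apply_clause _ ag); apply: mF.
  by apply/mem_applyP; exists C => //; rewrite CF.
by rewrite satc_apply_clause // mF.
Qed.

(** The literals left in [apply phi F] lie on variables that [phi] does not set, so overriding [a]
    by [phi] keeps their values. *)
Lemma model_override a phi F :
  model a (apply phi F) -> model (override a phi) F.
Proof.
move=> mF; rewrite -(model_apply _ (@override_agrees a phi)).
apply/allP=> C CF; move/allP/(_ _ CF)/hasP: mF => [x xC ax].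
case/mem_applyP: CF => D /andP[_ nD] CE; rewrite CE in xC *.
apply/hasP; exists x => //.
by rewrite /override (apply_clause_unset nD xC).
Qed.

Lemma sat_clause_restr (D : {fset var}) a (C : clause) :
  (forall x, x \in C -> x.1 \in D) -> sat_clause (restr D a) C = satc a C.
Proof.
move=> CD; apply: eq_in_has => x xC.
by rewrite /lit_val fnd_restr CD //=; case: (a x.1 == x.2).
Qed.

Lemma vars_lit (F : cnf) C x : C \in F -> x \in C -> x.1 \in vars F.
Proof. by move=> CF xC; apply/imfsetP; exists x => //; apply/occP; exists C. Qed.

Lemma apply_restr_top (D : {fset var}) a (F : cnf) :
  vars F `<=` D -> apply (restr D a) F = top <-> model a F.
Proof.
move=> /fsubsetP FD; rewrite apply_topP /model.
rewrite (eq_in_all (a2 := satc a)) // => C CF.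
by apply: sat_clause_restr => x xC; apply/FD/(vars_lit CF).
Qed.

Lemma satisfiableP (F : cnf) : satisfiable F <-> exists a, model a F.
Proof.
split=> [[phi E]|[a mF]]; last by exists (restr (vars F) a); apply/apply_restr_top.
exists (override xpred0 phi); apply: model_override.
by rewrite E; apply/allP=> C; rewrite inE.
Qed.

Lemma satisfiable_applyP phi F :
  satisfiable (apply phi F) <-> exists2 a, agrees a phi & model a F.
Proof.
rewrite satisfiableP; split=> [[a mF]|[a ag mF]].
  by exists (override a phi); [exact: override_agrees | exact: model_override].
by exists a; rewrite model_apply.
Qed.

(** Restricted to the variables of both clause-sets, [a] becomes a partial assignment that satisfies
    the same clauses as [a]. *)
Lemma equivalent_model F G : equivalent F G -> forall a, model a F = model a G.
Proof.
move=> FG a; set D := vars F `|` vars G; have := FG (restr D a).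
rewrite !apply_restr_top ?fsubsetUl ?fsubsetUr // => E.
by apply/idP/idP=> /E.
Qed.

Lemma agrees_set_lit a x e : agrees a (set_lit x e) <-> a x.1 = (e == x.2).
Proof.
split=> [/(_ x.1 (e == x.2)) ->//|E v b]; first by rewrite fnd_set eqxx.
by rewrite fnd_set fnd_fmap0; case: eqP => // -> [<-].
Qed.

(** * Horn clause-sets *)

Definition horn (F : cnf) : Prop :=
  forall C x y, C \in F -> x \in C -> y \in C -> x.2 -> y.2 -> x = y.

Lemma horn_apply phi F : horn F -> horn (apply phi F).
Proof.
move=> hF C x y /mem_applyP[D /andP[DF _] ->].
rewrite !mem_apply_clause => /andP[xD _] /andP[yD _]; exact: hF DF xD yD.
Qed.

Lemma unit_lit_None F y : unit_lit F = None -> [fset y] \notin F.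
Proof.
rewrite /unit_lit; case: pickP => // nF _; apply/negP=> yF.
have yo : y \in occ F by apply/occP; exists [fset y]; rewrite ?inE.
by move: (nF [` yo]); rewrite /= yF.
Qed.

Lemma unit_lit_Some F x : unit_lit F = Some x -> [fset val x] \in F.
Proof. by rewrite /unit_lit; case: pickP => // z zF [<-]. Qed.

(* Without empty and unit clauses, every clause has a negative literal. *)
Lemma horn_r1 F : horn F -> ~ satisfiable F -> r1 F = [fset bot].
Proof.
have [k] := ubnP (nvar F); elim: k F => // k IH F Fk hF uF.
rewrite r1E; case: ifPn => // bF; case E: (unit_lit F) => [x|].
  apply: IH; first exact: leq_trans (nvar_set_lit true (valP x)) Fk.
    exact: horn_apply.
  case/satisfiable_applyP=> a _ mF; apply: uF; apply/satisfiableP.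
  by exists a.
(* Propagation has stopped without a conflict, and the all-false assignment is a model. *)
case: uF; apply/satisfiableP; exists xpred0; apply/allP=> C CF.
apply/negPn/negP=> /hasPn nC.
have pos x : x \in C -> x.2 by move=> /nC /=; case: x.2.
case: (fset_0Vmem C) => [C0|[x xC]]; first by case/negP: bF; rewrite /bot -C0.
have CE : C = [fset x].
  apply/fsetP=> y; rewrite inE; apply/idP/eqP=> [yC|->//].
  by apply: (hF C) => //; exact: pos.
by move: (unit_lit_None x E); rewrite -CE CF.
Qed.

Lemma horn_UC F : is_clauseset F -> horn F -> UC F.
Proof. by move=> cF hF; split=> // phi; apply: horn_r1; exact: horn_apply. Qed.

(** * The clause-sets *)

Local Open Scope nat_scope.

Definition u (i : nat) : var := nseq i true.
Definition ch (b : bool) (i : nat) : var := nseq i true ++ [:: false; b].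

Definition step (i : nat) (b : bool) : seq literal :=
  [:: (u i, false); (ch b i, false); (u i.+1, true)].

Definition steps (m : nat) : seq (seq literal) :=
  flatten [seq [:: step i true; step i false] | i <- iota 0 m].

(** The variables [ch b m] are fresh, since [steps m] uses only indices below [m]. With [ch false m]
    first, a program can print two pads, one or none by entering the same code at different
    places. *)
Definition pads (m k : nat) : seq (seq literal) :=
  (if k >= 2 then [:: [:: (ch false m, true)]] else [::]) ++
  (if k >= 1 then [:: [:: (ch true m, true)]] else [::]).

(* [steps] has the 3m + 1 variables u_i (i <= m) and ch b i (i < m); the k
   variables that are still missing are put into unit clauses. *)
Definition chain_list (n : nat) : seq (seq literal) :=
  if n is n'.+1 then
    let m := n' %/ 3 in
    steps m ++ pads m (n' %% 3) ++ [:: [:: (u 0, false); (u m, false)]]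
  else [::].

Definition cnf_of (s : seq (seq literal)) : cnf :=
  seq_fset tt [seq seq_fset tt c | c <- s].

Definition chain (n : nat) : cnf := cnf_of (chain_list n).

Lemma u_inj : injective u.
Proof. by move=> i j /(congr1 size); rewrite !size_nseq. Qed.

Lemma ch_inj b c i j : ch b i = ch c j -> b = c /\ i = j.
Proof.
move=> E; split; first by move/(congr1 (last true)): E; rewrite !last_cat.
by move/(congr1 size): E; rewrite !size_cat !size_nseq => /addIn.
Qed.

Lemma ch_neq_u b i j : (ch b i == u j) = false.
Proof.
apply/eqP=> /(congr1 (all id)); rewrite all_cat all_nseq /= andbF.
by rewrite all_nseq orbT.
Qed.

Lemma u_neq_ch b i j : (u j == ch b i) = false.
Proof. by rewrite eq_sym ch_neq_u. Qed.

Lemma u_eq i j : (u i == u j) = (i == j).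
Proof. by apply: inj_eq; exact: u_inj. Qed.

Lemma mem_cnf_ofP s C :
  reflect (exists2 c, c \in s & C = seq_fset tt c) (C \in cnf_of s).
Proof. by rewrite seq_fsetE; apply: mapP. Qed.

Lemma mem_stepsP m c :
  reflect (exists i b, i < m /\ c = step i b) (c \in steps m).
Proof.
apply: (iffP flatten_mapP) => [[i]|[i [b [im ->]]]].
  rewrite mem_iota /= add0n => im; rewrite !inE => /orP[/eqP->|/eqP->];
  by [exists i, true | exists i, false].
exists i; first by rewrite mem_iota.
by case: b; rewrite !inE eqxx ?orbT.
Qed.

Lemma mem_pads m k c :
  c \in pads m k -> exists2 b, (if b then 1 else 2) <= k & c = [:: (ch b m, true)].
Proof.
rewrite mem_cat => /orP[]; case: ifP => // k1; rewrite inE => /eqP->;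
by [exists false | exists true].
Qed.

Lemma model_cnf_of a s :
  model a (cnf_of s) <-> forall c, c \in s -> has (fun x => a x.1 == x.2) c.
Proof.
split=> [/allP mF c cs|H].
  have /hasP[x] : satc a (seq_fset tt c) by apply: mF; apply/mem_cnf_ofP; exists c.
  by rewrite seq_fsetE => xc ax; apply/hasP; exists x.
apply/allP=> C /mem_cnf_ofP[c cs ->]; have /hasP[x xc ax] := H c cs.
by apply/hasP; exists x; rewrite ?seq_fsetE.
Qed.

(** For n = 3m + 1 there is no padding, and the clauses read as implications along the chain. *)
Lemma model_chain a m : model a (chain (3 * m).+1) <->
  (forall i b, i < m -> a (u i) -> a (ch b i) -> a (u i.+1)) /\
  ~~ (a (u 0) && a (u m)).
Proof.
rewrite model_cnf_of /= mulKn // modnMr.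
have last_c : has (fun x => a x.1 == x.2) [:: (u 0, false); (u m, false)]
    = ~~ (a (u 0) && a (u m)).
  by rewrite /=; case: (a (u 0)); case: (a (u m)).
split=> [H|[H1 H2] c].
  split; last by rewrite -last_c; apply: H; rewrite mem_cat inE eqxx orbT.
  move=> i b im ai ab; have := H (step i b).
  rewrite mem_cat (introT (mem_stepsP _ _)) /=; last by exists i, b.
  by rewrite ai ab => /(_ isT); case: (a _).
rewrite mem_cat => /orP[/mem_stepsP[i [b [im ->]]]|]; last first.
  by rewrite inE => /eqP->; rewrite last_c.
rewrite /=; have := H1 i b im; case: (a (u i)) => //; case: (a (ch b i)) => //.
by move=> -> .
Qed.

Lemma mem_chain_listS n c : (c \in chain_list n.+1) =
  [|| c \in steps (n %/ 3), c \in pads (n %/ 3) (n %% 3) |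
      c == [:: (u 0, false); (u (n %/ 3), false)]].
Proof. by rewrite -mem_seq1 -2!mem_cat. Qed.

Lemma chain_list_cases n c : c \in chain_list n ->
  [\/ exists i b, c = step i b, exists b i, c = [:: (ch b i, true)] |
      exists m, c = [:: (u 0, false); (u m, false)]].
Proof.
case: n => // n; rewrite mem_chain_listS => /or3P[/mem_stepsP|/mem_pads|].
- by move=> [i [b [_ ->]]]; constructor 1; exists i, b.
- by move=> [b _ ->]; constructor 2; exists b, (n %/ 3).
by move=> /eqP->; constructor 3; exists (n %/ 3).
Qed.

Lemma is_clauseset_chain n : is_clauseset (chain n).
Proof.
apply/allP=> C /mem_cnf_ofP[c cn ->]; apply/allP=> x; rewrite !seq_fsetE.
case: (chain_list_cases cn) => [[i [b ->]]|[b [i ->]]|[m ->]];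
  rewrite !inE.
- case/or3P=> /eqP->; rewrite /compl /= !xpair_eqE /= ?andbF ?andbT;
  (* Simplification has unfolded [u i.+1]; it is folded back so that [u_eq] applies. *)
  rewrite -[true :: u i]/(u i.+1) ?u_eq ?ch_neq_u ?u_neq_ch //;
  by rewrite eqn_leq ltnn ?andbF.
- by move=> /eqP->; rewrite xpair_eqE /= andbF.
by case/orP=> /eqP->; rewrite !xpair_eqE /= !andbF.
Qed.

Lemma horn_chain n : horn (chain n).
Proof.
move=> C x y /mem_cnf_ofP[c cn ->]; rewrite !seq_fsetE.
case: (chain_list_cases cn) => [[i [b ->]]|[b [i ->]]|[m ->]];
  rewrite !inE.
- by do 2![case/or3P=> /eqP->].
- by do 2!move/eqP->.
by do 2![case/orP=> /eqP->].
Qed.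

(** * The variables of the clause-sets, listed without repetition *)

Definition chain_vars (n : nat) : seq var :=
  if n is n'.+1 then
    let m := n' %/ 3 in
    [seq u i | i <- iota 0 m.+1] ++
    [seq ch true i | i <- iota 0 (m + (1 <= n' %% 3))] ++
    [seq ch false i | i <- iota 0 (m + (2 <= n' %% 3))]
  else [::].

Lemma chain_vars_uniq n : uniq (chain_vars n).
Proof.
case: n => // n; rewrite /chain_vars !cat_uniq !map_inj_uniq ?iota_uniq
  ?andbT ?andTb; first last.
- exact: u_inj.
- by move=> i j /ch_inj[].
- by move=> i j /ch_inj[].
apply/andP; split.
  apply/hasPn=> v; rewrite mem_cat => /orP[] /mapP[i _ ->];
  by apply/mapP=> -[j _ /eqP]; rewrite ch_neq_u.
by apply/hasPn=> v /mapP[i _ ->]; apply/mapP=> -[j _ /ch_inj[]].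
Qed.

Lemma size_chain_vars n : size (chain_vars n) = n.
Proof.
case: n => // n; rewrite /chain_vars !size_cat !size_map !size_iota.
have := divn_eq n 3; have : n %% 3 < 3 by rewrite ltn_mod.
by case: (n %% 3) => [|[|[|]]] //= _; lia.
Qed.

Lemma vars_cnf_ofP (s : seq (seq literal)) v :
  reflect (exists c x, [/\ c \in s, x \in c & v = x.1]) (v \in vars (cnf_of s)).
Proof.
apply: (iffP (imfsetP _ _ _ _)) => [[x /= /occP[C /mem_cnf_ofP[c cs ->]]]|].
  by rewrite seq_fsetE => xc ->; exists c, x.
move=> [c [x [cs xc ->]]]; exists x => //=; apply/occP.
by exists (seq_fset tt c); [apply/mem_cnf_ofP; exists c | rewrite seq_fsetE].
Qed.

Lemma vars_chain n : vars (chain n) =i chain_vars n.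
Proof.
case: n => [|n] v.
  by apply/negbTE/negP=> /vars_cnf_ofP[c [x []]].
set m := n %/ 3; set k := n %% 3.
have uP i : i <= m -> u i \in chain_vars n.+1.
  by move=> im; rewrite mem_cat map_f ?mem_iota.
have chP b i : i < m + ((if b then 1 else 2) <= k) -> ch b i \in chain_vars n.+1.
  rewrite !mem_cat; case: b => im.
    by rewrite (map_f (ch true)) ?orbT ?mem_iota.
  by rewrite (map_f (ch false)) ?orbT ?mem_iota.
apply/(vars_cnf_ofP (chain_list n.+1))/idP=> [[c [x [cn xc ->]]]|].
  move: cn; rewrite mem_chain_listS => /or3P[/mem_stepsP|/mem_pads|].
  - move=> [i [b [im cE]]]; move: xc; rewrite cE !inE.
    case/or3P=> /eqP->; [apply: (uP i)|apply: (chP b i)|apply: (uP i.+1)] => //.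
      exact: ltnW.
    exact: ltn_addr.
  - move=> [b bk cE]; move: xc; rewrite cE inE => /eqP->; apply: (chP b m).
    by rewrite bk addn1.
  move=> /eqP cE; move: xc; rewrite cE !inE.
  by case/orP=> /eqP->; [exact: (uP 0) | exact: (uP m)].
have stepP i b x : i < m -> x \in step i b ->
    exists c y, [/\ c \in chain_list n.+1, y \in c & x.1 = y.1].
  move=> im xs; exists (step i b), x; split=> //.
  by rewrite mem_chain_listS; apply/orP; left; apply/mem_stepsP; exists i, b.
rewrite !mem_cat => /or3P[] /mapP[i]; rewrite mem_iota add0n => /= im ->.
(* [u m] is taken from the final clause, which also covers m = 0; the smaller indices come from the
   steps. *)
- rewrite ltnS leq_eqVlt in im; case/orP: im => [/eqP->|im].
    exists [:: (u 0, false); (u m, false)], (u m, false).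
    by rewrite mem_chain_listS !inE !eqxx !orbT.
  by apply: (stepP i true (u i, false)); rewrite // !inE eqxx.
- have [im'|im'] := ltnP i m.
    by apply: (stepP i true (ch true i, false)); rewrite // !inE eqxx orbT.
  (* An index that is not below [m] must be [m] itself, and then its variable sits in a unit clause
     of the padding. *)
  case E: (0 < k) im; rewrite ?addn0 ?addn1; last by rewrite ltnNge im'.
  rewrite ltnS => im; have -> : i = m by apply/eqP; rewrite eqn_leq im.
  exists [:: (ch true m, true)], (ch true m, true).
  by rewrite mem_chain_listS /pads !mem_cat E !inE !eqxx !orbT.
have [im'|im'] := ltnP i m.
  by apply: (stepP i false (ch false i, false)); rewrite // !inE eqxx orbT.
case E: (1 < k) im; rewrite ?addn0 ?addn1; last by rewrite ltnNge im'.
rewrite ltnS => im; have -> : i = m by apply/eqP; rewrite eqn_leq im.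
exists [:: (ch false m, true)], (ch false m, true).
by rewrite mem_chain_listS /pads !mem_cat E !inE !eqxx !orbT.
Qed.

Lemma nvar_chain n : nvar (chain n) = n.
Proof.
rewrite -[RHS](size_chain_vars n) /nvar; apply/perm_size/uniq_perm.
- exact: fset_uniq.
- exact: chain_vars_uniq.
exact: vars_chain.
Qed.

(** * The lower bound for PC *)

Section LowerBound.

Variables (m : nat) (s : {ffun 'I_m -> bool}).

Definition chosen : {fset var} := [fset ch (s i) i | i : 'I_m].

Definition choice_clause : clause := [fset (v, false) | v in u 0 |` chosen].

Lemma chosenP v : reflect (exists i : 'I_m, v = ch (s i) i) (v \in chosen).
Proof.
by apply: (iffP (imfsetP _ _ _ _)) => [[i _ ->]|[i ->]]; exists i.
Qed.

Lemma mem_choice_clause v b :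
  ((v, b) \in choice_clause) = ~~ b && (v \in u 0 |` chosen).
Proof.
apply/imfsetP/andP=> [[w /= wc [-> ->]]//|[nb vc]].
by exists v => //; case: b nb.
Qed.

Lemma u_notin_chosen i : u i \notin chosen.
Proof. by apply/chosenP=> -[j /eqP]; rewrite u_neq_ch. Qed.

Lemma agrees_chosen a :
  agrees a (restr chosen xpredT) <-> forall i : 'I_m, a (ch (s i) i).
Proof.
split=> [ag i|H v b].
  by apply: ag; rewrite fnd_restr ifT //; apply/chosenP; exists i.
rewrite fnd_restr; case: ifP => // /chosenP[i ->] [<-]; exact: H.
Qed.

(** If [u 0] were true, the chosen variables would carry truth along the chain up to [u m], against
    the last clause. *)
Lemma chain_u0 a :
  model a (chain (3 * m).+1) -> agrees a (restr chosen xpredT) -> ~~ a (u 0).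
Proof.
move=> /model_chain[H1 H2] /agrees_chosen ag; apply/negP=> a0.
have au i : i <= m -> a (u i).
  elim: i => // i IH im.
  exact: (H1 i _ im (IH (ltnW im)) (ag (Ordinal im))).
by move: H2; rewrite a0 au.
Qed.

(* In these models every variable that is neither u_0 nor chosen takes both
   values. *)
Definition upper_model (t : nat) (b : bool) (v : var) : bool :=
  (v \in chosen) || (if v == u (size v) then t < size v else b).

Lemma upper_model_u t b i : upper_model t b (u i) = (t < i).
Proof.
by rewrite /upper_model (negbTE (u_notin_chosen i)) size_nseq eqxx.
Qed.

Lemma upper_model_chain t b : model (upper_model t b) (chain (3 * m).+1).
Proof.
apply/model_chain; split=> [i c _|]; rewrite !upper_model_u //.
by move=> ti _; exact: ltnW.
Qed.

Lemma upper_model_agrees t b :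
  agrees (upper_model t b) (restr chosen xpredT).
Proof.
by apply/agrees_chosen=> i; rewrite /upper_model; case: chosenP => // -[]; exists i.
Qed.

(** A variable that is neither chosen nor some [u j] has value [b]. For j > 0, [u j] is true at t =
    0 and false at t = j. Only [u 0] is constant, namely false. *)
Lemma upper_model_lit x : x.1 \notin chosen ->
  (forall t b, upper_model t b x.1 = x.2) -> x = (u 0, false).
Proof.
case: x => v e /= vc H; have := H 0; rewrite /upper_model (negbTE vc) /=.
case: eqP => [vE|_] /= H'; last by have := H' true; rewrite -(H' false).
case: (posnP (size v)) H' => [v0 /(_ true)<-|v0 /(_ true) H']; last first.
  have := H (size v) true.
  by rewrite /upper_model (negbTE vc) -vE eqxx ltnn -H'.
by rewrite vE v0.
Qed.

(** The chain is cut at [i]: truth spreads from [u 0] to [u i] and stops there, because [ch (s i) i]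
    is the one chosen variable made false. The test [v == u (size v)] recognises the names [u j]. *)
Definition lower_model (i : 'I_m) (v : var) : bool :=
  (v \in chosen) && (v != ch (s i) i) || (v == u (size v)) && (size v <= i).

Lemma lower_model_u i j : lower_model i (u j) = (j <= i).
Proof.
by rewrite /lower_model (negbTE (u_notin_chosen j)) size_nseq eqxx.
Qed.

Lemma lower_model_chain i : model (lower_model i) (chain (3 * m).+1).
Proof.
apply/model_chain; split=> [j b jm|]; rewrite !lower_model_u; last first.
  by rewrite -ltnNge.
rewrite leq_eqVlt => /orP[/eqP->|//]; rewrite /lower_model ch_neq_u orbF.
by case/andP=> /chosenP[k E]; case: (ch_inj E) => -> /val_inj->; rewrite eqxx.
Qed.

(** If the choice clause is missing, no clause of [F] shrinks to a unit or empty clause once the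
    chosen variables are true. Propagation then does nothing, although the negation of [u 0] is
    forced and [u 0] still occurs, which contradicts [PC]. *)
Lemma choice_clause_PC F :
  PC F -> equivalent F (chain (3 * m).+1) -> choice_clause \in F.
Proof.
move=> [cF pF] eF; have {}eF := equivalent_model eF.
set phi := restr chosen xpredT; set G := apply phi F.
have small (C : clause) (y : literal) : C \in F -> ~~ sat_clause phi C ->
    apply_clause phi C `<=` [fset y] -> C = choice_clause.
  move=> CF nC /fsubsetP Cy.
  have neg (x : literal) : x \in C -> x.1 \in chosen -> x.2 = false.
    move=> xC xc; move/hasPn/(_ _ xC): nC; rewrite /lit_val fnd_restr xc /=.
    by case: x.2.
  have open (x : literal) : x \in C -> x.1 \notin chosen -> x = y.
    move=> xC xc; apply/fset1P/Cy; rewrite mem_apply_clause xC.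
    by rewrite /lit_val fnd_restr (negbTE xc).
  (* Upper models make all chosen variables true, so they satisfy [C] through a literal on another
     variable; by [open] this literal is always [y]. *)
  have upperC t b : exists2 x : literal, x \in C &
      (x.1 \notin chosen) && (upper_model t b x.1 == x.2).
    have := upper_model_chain t b; rewrite -eF => /allP/(_ _ CF)/hasP[x xC ax].
    exists x; rewrite // ax andbT; apply/negP=> xc; move: ax.
    by rewrite (neg _ xC xc) /upper_model xc.
  have [x xC /andP[xc _]] := upperC 0 true.
  have xy := open _ xC xc.
  have y0 : y = (u 0, false).
    rewrite -xy; apply: upper_model_lit => // t b.
    have [z zC /andP[zc /eqP]] := upperC t b.
    by rewrite (open _ zC zc) -xy.
  apply/fsetP=> -[v b]; rewrite mem_choice_clause in_fset1U.
  apply/idP/andP=> [vC|[/negbTE-> /orP[/eqP->|/chosenP[i ->]]]]; last first.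
  (* In [lower_model i] the literal [y] and all negated chosen variables but that of index [i] are
     false, so [C] contains the latter. *)
  - have := lower_model_chain i; rewrite -eF => /allP/(_ _ CF)/hasP[z zC].
    have [zc|zc] := boolP (z.1 \in chosen).
      rewrite (neg _ zC zc) /lower_model zc; case: (z.1 =P ch (s i) i) => // zE _.
      by move: zC (neg _ zC zc); rewrite -zE; case: (z) => w c zC /= <-.
    by rewrite (open _ zC zc) y0 (lower_model_u i 0).
  - by rewrite -y0 -xy.
  have [vc|vc] := boolP (v \in chosen).
    by rewrite -[b]/(v, b).2 (neg _ vC vc) orbT.
  by move: (open _ vC vc); rewrite y0 => -[-> ->].
apply/negPn/negP=> nF.
have nbot : bot \notin G.
  apply/mem_applyP=> -[C /andP[CF nC] E]; case/negP: nF.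
  (* The literal is arbitrary, since the empty clause lies in every singleton. *)
  by rewrite -(small C (u 0, true)) // -E; apply: fsub0set.
have r1G : r1 G = G.
  rewrite r1E (negbTE nbot); case E: (unit_lit G) => [y|] //.
  have /mem_applyP[C /andP[CF nC] CE] := unit_lit_Some E.
  case/negP: nF; rewrite -(small C (val y)) // -CE; exact: fsubset_refl.
apply: (pF phi (u 0, false)); rewrite -/G r1G; last first.
  case/satisfiable_applyP=> a /agrees_set_lit /= a0 mG.
  have mF : model (override a phi) (chain (3 * m).+1) by rewrite -eF model_override.
  have := chain_u0 mF (@override_agrees a phi).
  by rewrite /override fnd_restr (negbTE (u_notin_chosen 0)) a0.
(* If [u 0] did not occur in [G], it could be switched to true in an upper model, against
   [chain_u0]. *)
apply/negPn/negP=> uG; set a := fun v => (v == u 0) || upper_model 0 true v.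
have ag : agrees a phi.
  apply/agrees_chosen=> i; apply/orP; right.
  by apply: (iffLR (agrees_chosen _)); exact: upper_model_agrees.
suff mF : model a (chain (3 * m).+1).
  by have := chain_u0 mF ag; rewrite /a eqxx.
rewrite -eF -(model_apply _ ag); apply/allP=> C CG.
have : model (upper_model 0 true) G.
  by rewrite (model_apply _ (@upper_model_agrees 0 true)) eF upper_model_chain.
move=> /allP/(_ _ CG)/hasP[x xC xT]; apply/hasP; exists x => //.
rewrite /a; case: (x.1 =P u 0) => // x0; case/negP: uG; rewrite -x0.
exact: vars_lit CG xC.
Qed.

End LowerBound.

(** * Exponentially many clauses *)

Lemma choice_clause_inj m : injective (@choice_clause m).
Proof.
move=> s t E; apply/ffunP=> i.
have : (ch (s i) i, false) \in choice_clause t.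
  rewrite -E mem_choice_clause in_fset1U; apply/orP; right.
  by apply/chosenP; exists i.
rewrite mem_choice_clause in_fset1U ch_neq_u => /chosenP[j E'].
by have [-> /val_inj->] := ch_inj E'.
Qed.

(** The 2^m choice clauses are distinct and nonempty, and each nonempty clause adds at least 1 to
    [ell]. *)
Lemma ell_PC_chain m F :
  PC F -> equivalent F (chain (3 * m).+1) -> 2 ^ m <= ell F.
Proof.
move=> pF eF; pose ne (C : clause) := 0 < #|` C|.
have <- : size [seq choice_clause s | s : {ffun 'I_m -> bool}] = 2 ^ m.
  by rewrite size_image card_ffun card_bool card_ord.
apply: (@leq_trans (size (filter ne F))).
  apply: uniq_leq_size => [|C /imageP[s _ ->]].
    by rewrite map_inj_uniq ?enum_uniq //; exact: choice_clause_inj.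
  rewrite mem_filter choice_clause_PC // andbT /ne cardfs_gt0.
  by apply/fset0Pn; exists (u 0, false); rewrite mem_choice_clause in_fset1U eqxx.
rewrite size_filter -sum1_count /ell big_mkcond /=; apply: leq_sum => C _.
by rewrite /ne; case: (#|` C|).
Qed.

Lemma exp_beats_poly k N : exists2 m, N <= (3 * m).+1 & (3 * m).+1 ^ k < 2 ^ m.
Proof.
have lt j : j < 2 ^ j by exact: ltn_expl.
have le3 j : 2 * (j + 3) + 2 <= 2 ^ (j + 3).
  by elim: j => // j IH; rewrite addSn expnS; lia.
(* With m = 2^(2a), 3m + 1 is at most 2^(2a+2), so (2a+2)k < 2^(2a) suffices. This follows from 2a +
   2 <= 2^a and k < 2^a. *)
set a := k + N + 3; exists (2 ^ (2 * a)).
  by have := lt (2 * a); rewrite /a; lia.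
apply: (@leq_ltn_trans (2 ^ ((2 * a + 2) * k))).
  have [->|k0] := posnP k; first by rewrite muln0.
  by rewrite [leqRHS]expnM leq_exp2r // expnD; have := lt (2 * a); lia.
rewrite ltn_exp2l // mul2n -addnn expnD.
have h1 := le3 (k + N); have h2 := lt a; rewrite -/a in h1.
by apply: (@leq_ltn_trans (2 ^ a * k)); nia.
Qed.

(** * Counter programs *)

(* The four tapes hold the input, a counter, an auxiliary counter and the
   output. Both counter tapes carry a marker in cell 0, and the value of a
   counter is the position of its head. [Back] empties the first counter into
   the second one and [Forth] does the reverse, both writing one 1 per step. *)
Inductive instr : Type :=
  Emit of bool | Back | Forth | Inc | Read of nat | Jump of nat | Halt.

Record state : Type := State {
  st_pc : nat; st_in : nat; st_ctr : nat; st_aux : nat; st_out : seq bool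
}.

Definition fetch (p : seq instr) (pc : nat) : instr := nth Halt p pc.

Definition exec (p : seq instr) (n : nat) (s : state) : state :=
  let: State pc j a b o := s in
  match fetch p pc with
  | Emit e => State pc.+1 j a b (rcons o e)
  | Back => if a is a'.+1 then State pc j a' b.+1 (rcons o true)
            else State pc.+1 j a b o
  | Forth => if b is b'.+1 then State pc j a.+1 b' (rcons o true)
             else State pc.+1 j a b o
  | Inc => State pc.+1 j a.+1 b o
  | Read l => if j < n then State pc.+1 j.+1 a b o else State l j a b o
  | Jump l => State l j a b o
  | Halt => s
  end.

Definition is_halt (i : instr) : bool := if i is Halt then true else false.

(** Labels up to [L] fit into ['I_L.+1], so [inord] preserves them. *)
Definition label_ok (L : nat) (i : instr) : bool :=
  match i with Read l | Jump l => l <= L | _ => true end.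

Definition tape_in : 'I_4 := ord0.
Definition tape_ctr : 'I_4 := @Ordinal 4 1 isT.
Definition tape_aux : 'I_4 := @Ordinal 4 2 isT.
Definition tape_out : 'I_4 := ord_max.

(** The first three tapes get back the symbol just read, so their contents never change; only the
    output tape is written, and only when [e] is not [None]. *)
Definition action (sym : 'I_4 -> option bool) (e : option bool)
    (mi mc ma : move) (i : 'I_4) : option bool * move :=
  match val i with
  | 0 => (sym i, mi)
  | 1 => (sym i, mc)
  | 2 => (sym i, ma)
  | _ => if e is Some _ then (e, MoveR) else (sym i, Stay)
  end.

Definition machine_state (p : seq instr) : finType := option 'I_(size p).+1.

(** A counter head sees a symbol only on the marker in cell 0, which gives the zero test. The extra
    state [None] is the start and writes both markers. *)
Definition machine_delta (p : seq instr) (q : machine_state p)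
    (sym : {ffun 'I_4 -> option bool}) :
    machine_state p * ('I_4 -> option bool * move) :=
  if q is Some pc then
    let goto l : machine_state p := Some (inord l) in
    let next := goto pc.+1 in
    match fetch p pc with
    | Emit e => (next, action sym (Some e) Stay Stay Stay)
    | Back => if sym tape_ctr is Some _ then (next, action sym None Stay Stay Stay)
              else (q, action sym (Some true) Stay MoveL MoveR)
    | Forth => if sym tape_aux is Some _ then (next, action sym None Stay Stay Stay)
               else (q, action sym (Some true) Stay MoveR MoveL)
    | Inc => (next, action sym None Stay MoveR Stay)
    | Read l => if sym tape_in is Some _ then (next, action sym None MoveR Stay Stay)
                else (goto l, action sym None Stay Stay Stay)
    | Jump l => (goto l, action sym None Stay Stay Stay)
    | Halt => (q, action sym None Stay Stay Stay)
    end
  else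
    (Some ord0, fun i => (if i \in [:: tape_ctr; tape_aux] then Some false
                          else sym i, Stay)).

Definition machine_halt (p : seq instr) : pred (machine_state p) :=
  fun q => if q is Some pc then is_halt (fetch p pc) else false.

Definition machine (p : seq instr) : tm :=
  @TM 3 (machine_state p) None (@machine_halt p) (@machine_delta p).

Definition marker (k : nat) : option bool :=
  if k is 0 then Some false else None.

Definition simulates (p : seq instr) (n : nat) (c : config (machine p))
    (s : state) : Prop :=
  [/\ st_pc s <= size p /\ cf_state c = Some (inord (st_pc s)),
      cf_tape c tape_in =1 onth (nseq n true) /\ cf_head c tape_in = st_in s,
      cf_tape c tape_ctr =1 marker /\ cf_head c tape_ctr = st_ctr s,
      cf_tape c tape_aux =1 marker /\ cf_head c tape_aux = st_aux s &
      cf_tape c tape_out =1 onth (st_out s) /\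
      cf_head c tape_out = size (st_out s)].

Lemma onth_rcons_if (T : Type) (o : seq T) e k :
  onth (rcons o e) k = if k == size o then Some e else onth o k.
Proof. by elim: o k => [|x o IH] [|k] //=; rewrite onth0n. Qed.

Lemma simulates_step p n c s :
  all (label_ok (size p)) p ->
  simulates n c s -> simulates n (@tm_step (machine p) c) (exec p n s).
Proof.
case: c => q tp hd; case: s => pc j a b o okp.
move=> [/= [lepc ->]] [t0 h0] [t1 h1] [t2 h2] [t3 h3].
rewrite /tm_step /= /machine_halt inordK //.
set sym := [ffun i => tp i (hd i)].
(* Apart from [Halt], every transition is one [action] followed by a change of address, so this
   covers them all. *)
have key e l mi mc ma : l <= size p -> simulates n
    (@Config (machine p) (Some (inord l))
       (fun i k => if k == hd i then (action sym e mi mc ma i).1 else tp i k)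
       (fun i => move_head (action sym e mi mc ma i).2 (hd i)))
    (State l (move_head mi j) (move_head mc a) (move_head ma b)
       (if e is Some x then rcons o x else o)).
  move=> lel; split; split=> //=; try by rewrite /action /= ?h0 ?h1 ?h2.
  - by move=> k; rewrite /action /= ffunE; case: eqP => [->|_]; rewrite t0.
  - by move=> k; rewrite /action /= ffunE; case: eqP => [->|_]; rewrite t1.
  - by move=> k; rewrite /action /= ffunE; case: eqP => [->|_]; rewrite t2.
  - move=> k; rewrite /action /= ffunE h3.
    case: e => [x|]; first by rewrite onth_rcons_if t3.
    by rewrite t3 /=; case: eqP => [->|].
  by rewrite /action /= h3; case: e => [x|] //=; rewrite size_rcons.
have lt : ~~ is_halt (fetch p pc) -> pc < size p.
  by apply: contraR; rewrite -leqNgt /fetch => g; rewrite nth_default.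
have okl : label_ok (size p) (fetch p pc).
  have [ltp|gep] := ltnP pc (size p); last by rewrite /fetch nth_default.
  exact: (all_nthP Halt okp).
case E: (fetch p pc) lt okl => [e||||l|l|] /= lt okl.
all: try have {}lt := lt isT.
all: rewrite ?ffunE /= ?h0 ?h1 ?h2 ?t0 ?t1 ?t2 ?onth_nseq.
- exact: (key (Some e)).
- case: a h1 key => [|a] h1 key /=; first exact: (key None).
  exact: (key (Some true) pc Stay MoveL MoveR).
- case: b h2 key => [|b] h2 key /=; first exact: (key None).
  exact: (key (Some true) pc Stay MoveR MoveL).
- exact: (key None _ Stay MoveR Stay).
- case: (j < n); last exact: (key None).
  exact: (key None _ MoveR Stay Stay).
- exact: (key None).
by split.
Qed.

Lemma simulates_init p n : simulates n
  (@tm_step (machine p) (tm_init (machine p) (nseq n true))) (State 0 0 0 0 [::]).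
Proof.
split; split=> //=.
- by congr Some; apply: val_inj; rewrite /= inordK.
- by move=> k; rewrite ffunE /=; case: eqP => [->|].
- by case.
- by case.
by move=> k; rewrite ffunE onth0n if_same.
Qed.

Lemma simulates_iter p n t c s : all (label_ok (size p)) p ->
  simulates n c s ->
  simulates n (iter t (@tm_step (machine p)) c) (iter t (exec p n) s).
Proof. by move=> okp cs; elim: t => //= t IH; exact: simulates_step. Qed.

(** The number of steps is only bounded, so that costs can be rounded up. *)
Definition reach (p : seq instr) (n t : nat) (s s' : state) : Prop :=
  exists2 k, k <= t & iter k (exec p n) s = s'.

Lemma reach_refl p n s : reach p n 0 s s.
Proof. by exists 0. Qed.

Lemma reach_trans p n t1 t2 s1 s2 s3 :
  reach p n t1 s1 s2 -> reach p n t2 s2 s3 -> reach p n (t1 + t2) s1 s3.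
Proof.
move=> [k1 k1t <-] [k2 k2t <-]; exists (k2 + k1); last exact: iterD.
by rewrite addnC leq_add.
Qed.

Lemma reach_Emit p n pc j a b o e : fetch p pc = Emit e ->
  reach p n 1 (State pc j a b o) (State pc.+1 j a b (rcons o e)).
Proof. by move=> E; exists 1; rewrite //= E. Qed.

Lemma reach_Inc p n pc j a b o : fetch p pc = Inc ->
  reach p n 1 (State pc j a b o) (State pc.+1 j a.+1 b o).
Proof. by move=> E; exists 1; rewrite //= E. Qed.

Lemma reach_Jump p n pc j a b o l : fetch p pc = Jump l ->
  reach p n 1 (State pc j a b o) (State l j a b o).
Proof. by move=> E; exists 1; rewrite //= E. Qed.

Lemma reach_Read p n pc j a b o l : fetch p pc = Read l ->
  reach p n 1 (State pc j a b o)
    (if j < n then State pc.+1 j.+1 a b o else State l j a b o).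
Proof. by move=> E; exists 1; rewrite //= E. Qed.

Lemma reach_leq p n t t' s s' : t <= t' -> reach p n t s s' -> reach p n t' s s'.
Proof. by move=> tt [k kt E]; exists k => //; exact: leq_trans kt tt. Qed.

(** The extra step writes the markers. Halting early is harmless, as a halted state no longer
    changes. *)
Lemma machine_outputs p n t s : all (label_ok (size p)) p ->
  reach p n t (State 0 0 0 0 [::]) s -> fetch p (st_pc s) = Halt ->
  tm_outputs (machine p) (nseq n true) t.+1 (st_out s).
Proof.
move=> okp [k kt E] hs; rewrite /tm_outputs iterSr.
have stop i : iter i (exec p n) s = s.
  by elim: i => //= i ->; case: s hs {E} => pc j a b o /= ->.
have Et : iter t (exec p n) (State 0 0 0 0 [::]) = s.
  by rewrite -(subnK kt) iterD E stop.
have := simulates_iter t okp (simulates_init p n); rewrite Et.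
case: (iter _ _ _) => q tp hd.
by move=> [/= [pcp ->] _ _ _ [tpo _]]; rewrite /machine_halt inordK // hs.
Qed.

(** * Printing clauses *)

(* [None] stands for the unary code [1^(2i)] of the counter value i. *)
Definition token : Type := option bool.

(** [enc_var] puts a 1 before every bit, so a prefix 1^i is encoded by 2i ones: i printed by [Back]
    and i by [Forth], which also restores the counter. *)
Definition token_code (x : token) : seq instr :=
  if x is Some e then [:: Emit e] else [:: Back; Forth].

Definition token_out (i : nat) (x : token) : seq bool :=
  if x is Some e then [:: e] else nseq i true ++ nseq i true.

Definition code (w : seq token) : seq instr := flatten (map token_code w).

Definition printed (i : nat) (w : seq token) : seq bool :=
  flatten (map (token_out i) w).

Definition code_at (p : seq instr) (pc : nat) (c : seq instr) : Prop :=
  forall k, k < size c -> fetch p (pc + k) = nth Halt c k.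

Lemma code_at_cat p pc c1 c2 :
  code_at p pc (c1 ++ c2) -> code_at p pc c1 /\ code_at p (pc + size c1) c2.
Proof.
move=> H; split=> k kc.
  by rewrite H ?nth_cat ?kc // size_cat ltn_addr.
by rewrite -addnA H ?size_cat ?ltn_add2l // nth_cat ltnNge leq_addr /= addKn.
Qed.

Lemma reach_Back p n pc j i b o : fetch p pc = Back ->
  reach p n i.+1 (State pc j i b o) (State pc.+1 j 0 (i + b) (o ++ nseq i true)).
Proof.
move=> E; elim: i b o => [|i IH] b o.
  by rewrite cats0; exists 1; rewrite //= E.
apply: (@reach_trans _ _ 1 _ _ (State pc j i b.+1 (rcons o true))).
  by exists 1; rewrite //= E.
by have := IH b.+1 (rcons o true); rewrite cat_rcons addnS.
Qed.

Lemma reach_Forth p n pc j a i o : fetch p pc = Forth ->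
  reach p n i.+1 (State pc j a i o) (State pc.+1 j (i + a) 0 (o ++ nseq i true)).
Proof.
move=> E; elim: i a o => [|i IH] a o.
  by rewrite cats0; exists 1; rewrite //= E.
apply: (@reach_trans _ _ 1 _ _ (State pc j a.+1 i (rcons o true))).
  by exists 1; rewrite //= E.
by have := IH a.+1 (rcons o true); rewrite cat_rcons addnS.
Qed.

(** A token costs at most 2(i+1) steps: [Back] and [Forth] need i + 1 each, including the test at
    zero. *)
Lemma reach_code p n w pc j i o : code_at p pc (code w) ->
  reach p n (size w * (2 * i.+1)) (State pc j i 0 o)
    (State (pc + size (code w)) j i 0 (o ++ printed i w)).
Proof.
elim: w pc o => [|x w IH] pc o.
  by rewrite addn0 cats0 => _; exact: reach_refl.
rewrite [code _]/(token_code x ++ code w).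
rewrite [printed _ _]/(token_out i x ++ printed i w).
rewrite size_cat addnA catA => /code_at_cat[hx hw].
rewrite [size (x :: w) * _]mulSn.
apply: (reach_trans _ (IH _ _ hw)); case: x hx {IH hw} => [e|] hx /=.
  have E : fetch p pc = Emit e by rewrite -[pc]addn0 hx.
  apply: (@reach_leq _ _ 1); first by lia.
  by rewrite addn1 cats1; exact: reach_Emit.
have E1 : fetch p pc = Back by rewrite -[pc]addn0 hx.
have E2 : fetch p pc.+1 = Forth by rewrite -addn1 hx.
rewrite mul2n -addnn catA addn2; apply: (reach_trans (reach_Back _ _ _ _ _ E1)).
by have := reach_Forth n j 0 (i + 0) (o ++ nseq i true) E2; rewrite !addn0.
Qed.

(* A literal whose variable is the given tag, preceded by 1^i if the first
   component is true. *)
Definition pattern : Type := (bool * seq bool * bool)%type.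

Definition instance (i : nat) (l : pattern) : literal :=
  let: (rep, tag, e) := l in (nseq (if rep then i else 0) true ++ tag, e).

(** The first token announces a further literal in the list of the clause, the second is its sign,
    and the last closes the variable. *)
Definition pattern_word (l : pattern) : seq token :=
  let: (rep, tag, e) := l in
  [:: Some true; Some e] ++ (if rep then [:: None] else [::]) ++
  flatten [seq [:: Some true; Some b] | b <- tag] ++ [:: Some false].

Definition clause_word (c : seq pattern) : seq token :=
  Some true :: flatten (map pattern_word c) ++ [:: Some false].

Lemma printed_cat i w1 w2 : printed i (w1 ++ w2) = printed i w1 ++ printed i w2.
Proof. by rewrite /printed map_cat flatten_cat. Qed.

Lemma enc_varE v : enc_var v = flatten [seq [:: true; b] | b <- v] ++ [:: false].
Proof. by rewrite /enc_var /enc_seq cats1. Qed.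

Lemma flatten_nseq_pair i :
  flatten [seq [:: true; b] | b <- nseq i true] = nseq i true ++ nseq i true.
Proof.
by rewrite -nseqD addnn; elim: i => // i IH; rewrite doubleS /= IH.
Qed.

Lemma printed_pattern i l :
  printed i (pattern_word l) = true :: enc_literal (instance i l).
Proof.
case: l => [[rep tag] e].
rewrite /pattern_word !printed_cat /enc_literal /= enc_varE.
rewrite map_cat flatten_cat flatten_nseq_pair -!catA.
have -> : printed i (flatten [seq [:: Some true; Some b] | b <- tag]) =
    flatten [seq [:: true; b] | b <- tag].
  by elim: tag => // b tag IH; rewrite /= -IH.
by case: rep; rewrite /= ?cats0 -?catA.
Qed.

Lemma printed_clause i c : printed i (clause_word c) =
  true :: enc_seq enc_literal (map (instance i) c).
Proof.
rewrite /clause_word -cat1s !printed_cat /enc_seq -cats1 /=; congr (_ :: _ ++ _).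
by elim: c => //= l c IH; rewrite printed_cat printed_pattern IH.
Qed.

(** [u i.+1] is 1^i followed by the tag 1, so the counter need not be increased within a clause. *)
Definition step_pattern (b : bool) : seq pattern :=
  [:: (true, [::], false); (true, [:: false; b], false); (true, [:: true], true)].

Definition pad_pattern (b : bool) : seq pattern := [:: (true, [:: false; b], true)].

Definition final_pattern : seq pattern :=
  [:: (false, [::], false); (true, [::], false)].

Lemma instance_step i b : map (instance i) (step_pattern b) = step i b.
Proof. by rewrite /step /u -[i.+1]addn1 nseqD /= cats0. Qed.

Lemma instance_final i :
  map (instance i) final_pattern = [:: (u 0, false); (u i, false)].
Proof. by rewrite /= cats0. Qed.

(** * The program that prints the clause-sets *)

Definition step_word : seq token :=
  clause_word (step_pattern true) ++ clause_word (step_pattern false).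
Definition pad_word (b : bool) : seq token := clause_word (pad_pattern b).
Definition final_word : seq token := clause_word final_pattern.

(** The 6 counts the four [Read] instructions and the closing [Inc] and [Jump] of the loop. *)
Definition pc_pad2 : nat := 6 + size (code step_word).
Definition pc_pad1 : nat := pc_pad2 + size (code (pad_word false)).
Definition pc_final : nat := pc_pad1 + size (code (pad_word true)).
Definition pc_end : nat := pc_final + size (code final_word).

(* Each round of the loop at address 1 reads three further input cells; when
   the input ends, the jump target depends on the remainder mod 3. *)
Definition prog : seq instr :=
  [:: Read pc_end; Read pc_final; Read pc_pad1; Read pc_pad2] ++
  code step_word ++ [:: Inc; Jump 1] ++
  code (pad_word false) ++ code (pad_word true) ++ code final_word ++
  [:: Emit false; Halt].

Lemma prog_labels : all (label_ok (size prog)) prog.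
Proof. by vm_compute. Qed.

Lemma prog_code :
  [/\ code_at prog 4 (code step_word),
      code_at prog pc_pad2 (code (pad_word false)),
      code_at prog pc_pad1 (code (pad_word true)) &
      code_at prog pc_final (code final_word)].
Proof.
(* Every block has fewer than 100 instructions, so all positions are inspected. *)
by split; move=> k; rewrite /fetch; do 100?[case: k => [|k] //=].
Qed.

(** The 5 counts three [Read]s, [Inc] and [Jump]; the tokens are charged at the bound [m] on the
    counter. *)
Definition body_time (m : nat) : nat := size step_word * (2 * m.+1) + 5.

Definition clause_enc (c : seq literal) : seq bool :=
  true :: enc_seq enc_literal c.

Lemma steps_S m : steps m.+1 = steps m ++ [:: step m true; step m false].
Proof. by rewrite /steps -addn1 iotaD map_cat flatten_cat. Qed.

(** Loop invariant at address 1. The cell and the step beyond the [i] rounds belong to the [Read] at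
    address 0, and 3m < n ensures that no [Read] in these rounds meets the end of the input. *)
Lemma reach_loop n m i : i <= m -> 3 * m < n ->
  reach prog n (1 + i * body_time m) (State 0 0 0 0 [::])
    (State 1 (3 * i).+1 i 0 (flatten (map clause_enc (steps i)))).
Proof.
have read pc j a b o : pc < 4 -> j < n ->
    reach prog n 1 (State pc j a b o) (State pc.+1 j.+1 a b o).
  by move=> + jn; case: pc => [|[|[|[|]]]] // _; exists 1; rewrite //= jn.
move=> im mn; elim: i im => [_|i IH im]; first by apply: read => //; lia.
rewrite mulSnr addnA; apply: (reach_trans (IH (ltnW im))); set o := flatten _.
apply: (@reach_leq _ _ (1 + (1 + (1 + (size step_word * (2 * i.+1) + (1 + 1)))))).
  by rewrite /body_time; nia.
apply: (reach_trans (read _ _ _ _ _ _ _)) => //; first by lia.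
apply: (reach_trans (read _ _ _ _ _ _ _)) => //; first by lia.
apply: (reach_trans (read _ _ _ _ _ _ _)) => //; first by lia.
have [cs _ _ _] := prog_code.
apply: (reach_trans (reach_code _ _ _ _ cs)).
have eInc : fetch prog (4 + size (code step_word)) = Inc by [].
have eJump : fetch prog (4 + size (code step_word)).+1 = Jump 1 by [].
apply: (reach_trans (reach_Inc _ _ _ _ _ eInc)).
have -> : (3 * i.+1).+1 = (3 * i).+4 by lia.
have -> : flatten (map clause_enc (steps i.+1)) = o ++ printed i step_word.
  rewrite steps_S map_cat flatten_cat printed_cat !printed_clause !instance_step.
  have fl (x y : seq bool) : flatten [:: x; y] = x ++ y by rewrite /= cats0.
  congr (_ ++ _); exact: fl.
exact: reach_Jump.
Qed.

Definition total_time (n : nat) : nat :=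
  (size step_word + size (pad_word false) + size (pad_word true) +
   size final_word + 10) * 4 * n.+1 ^ 2.

(** After [m] rounds, as many input cells are left as pads are needed. The [Read] that meets the end
    of the input jumps to the code for that number of pads, which runs on into the final clause. *)
Lemma reach_prog n : reach prog n (total_time n) (State 0 0 0 0 [::])
  (State pc_end.+1 n (n.-1 %/ 3) 0 (enc_cnf (chain_list n))).
Proof.
have encE s : enc_cnf s = rcons (flatten (map clause_enc s)) false by [].
have eEnd : fetch prog pc_end = Emit false by [].
case: n => [|n].
  (* On empty input the first [Read] jumps to the end, and only the closing 0 is printed. *)
  apply: (@reach_leq _ _ (1 + 1)) => //.
  apply: (reach_trans (reach_Read _ _ _ _ _ (erefl : fetch prog 0 = Read pc_end))).
  exact: (reach_Emit _ 0 0 0 [::] eEnd).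
set m := n %/ 3; have n3 : n %% 3 < 3 by rewrite ltn_mod.
have nE : n = 3 * m + n %% 3 by rewrite mulnC -divn_eq.
have mn : 3 * m < n.+1 by lia.
pose t2 := size (pad_word false) * (2 * m.+1).
pose t1 := size (pad_word true) * (2 * m.+1).
pose tF := size final_word * (2 * m.+1).
(* After the loop there are at most three [Read]s, the pads, the final clause and one closing
   symbol. *)
apply: (@reach_leq _ _ (1 + m * body_time m + (3 + (t2 + (t1 + (tF + 1)))))).
  have mX : m.+1 ^ 2 <= n.+2 ^ 2 by rewrite leq_exp2r //; lia.
  apply: leq_trans (leq_mul (leqnn _) mX).
  rewrite /body_time /t2 /t1 /tF.
  move: (size _) (size _) (size _) (size _) => A B C D.
  clear; nia.
apply: (reach_trans (reach_loop (leqnn m) mn)).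
have [_ c2 c1 cf] := prog_code; set o := flatten _.
have outF : printed m final_word = clause_enc [:: (u 0, false); (u m, false)].
  by rewrite printed_clause instance_final.
have outP b : printed m (pad_word b) = clause_enc [:: (ch b m, true)].
  exact: printed_clause.
have -> : enc_cnf (chain_list n.+1) = rcons (o ++
    ((if 2 <= n %% 3 then printed m (pad_word false) else [::]) ++
     (if 1 <= n %% 3 then printed m (pad_word true) else [::])) ++
    printed m final_word) false.
  rewrite encE outF /chain_list !map_cat !flatten_cat [flatten (map _ [:: _])]cats0.
  by rewrite !outP; case: ifP => _; case: ifP => _;
    rewrite /clause_enc /enc_seq /= ?cats0.
have fin o' : reach prog n.+1 (tF + 1)
    (State pc_final n.+1 m 0 o')
    (State pc_end.+1 n.+1 m 0 (rcons (o' ++ printed m final_word) false)).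
  by apply: (reach_trans (reach_code _ _ _ _ cf)); exact: reach_Emit.
have pad2 o' : reach prog n.+1 t2 (State pc_pad2 n.+1 m 0 o')
    (State pc_pad1 n.+1 m 0 (o' ++ printed m (pad_word false))).
  exact: reach_code c2.
have pad1 o' : reach prog n.+1 t1 (State pc_pad1 n.+1 m 0 o')
    (State pc_final n.+1 m 0 (o' ++ printed m (pad_word true))).
  exact: reach_code c1.
clearbody t1 t2 tF; move: fin pad2 pad1; clear outF outP.
move: (printed m final_word) (printed m (pad_word false))
  (printed m (pad_word true)) => dF d2 d1 fin pad2 pad1.
have read pc j l : fetch prog pc = Read l -> j <= n ->
    reach prog n.+1 1 (State pc j m 0 o) (State pc.+1 j.+1 m 0 o).
  by move=> /reach_Read; move/(_ n.+1 j m 0 o) => + jn; rewrite ltnS jn.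
have stop pc l : fetch prog pc = Read l ->
    reach prog n.+1 1 (State pc n.+1 m 0 o) (State l n.+1 m 0 o).
  by move=> /reach_Read; move/(_ n.+1 n.+1 m 0 o); rewrite ltnn.
case: (n %% 3) n3 nE => [|[|[|]]] //= _ nE; rewrite ?catA.
- have -> : 3 * m = n by lia.
  apply: (@reach_leq _ _ (1 + (tF + 1))); first by lia.
  by apply: (reach_trans (stop 1 _ erefl)); exact: fin.
- apply: (@reach_leq _ _ (1 + (1 + (t1 + (tF + 1))))); first by lia.
  apply: (reach_trans (read 1 _ _ erefl _)); first by lia.
  have -> : (3 * m).+2 = n.+1 by lia.
  apply: (reach_trans (stop 2 _ erefl)).
  by apply: (reach_trans (pad1 _)); exact: fin.
apply: (@reach_leq _ _ (1 + (1 + (1 + (t2 + (t1 + (tF + 1))))))); first by lia.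
apply: (reach_trans (read 1 _ _ erefl _)); first by lia.
apply: (reach_trans (read 2 _ _ erefl _)); first by lia.
have -> : (3 * m).+3 = n.+1 by lia.
apply: (reach_trans (stop 3 _ erefl)); apply: (reach_trans (pad2 _)).
by apply: (reach_trans (pad1 _)); exact: fin.
Qed.

Lemma poly_total_time : poly_bounded (fun n => (total_time n).+1).
Proof.
rewrite /poly_bounded /total_time.
(* For n >= 4c + 1, c(n+1)^2 + 1 is at most 4cn^2 + n^2, hence at most n^3. *)
move: (_ * 4) => c; exists 3, (4 * c + 1) => n cn.
apply: (@leq_trans (c * (4 * n ^ 2) + n ^ 2)); last by rewrite (expnS n 2); nia.
have n0 : 0 < n by lia.
have n1 : n.+1 ^ 2 <= 4 * n ^ 2 by rewrite -[4]/(2 ^ 2) -expnMn leq_exp2r; lia.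
have n2 : 0 < n ^ 2 by rewrite expn_gt0 n0.
by nia.
Qed.

Lemma poly_time_chain : poly_time chain.
Proof.
exists (machine prog), (fun n => (total_time n).+1); split.
  exact: poly_total_time.
move=> n; exists (chain_list n) => //.
exact: (machine_outputs prog_labels (reach_prog n)).
Qed.

Theorem theorem8p1 :
  exists F : nat -> cnf,
    [/\ forall n, UC (F n),
        forall n, nvar (F n) = n,
        poly_time F &
        ~ exists F' : nat -> cnf,
            [/\ forall n, PC (F' n),
                forall n, equivalent (F' n) (F n) &
                poly_bounded (fun n => ell (F' n))]].
Proof.
exists chain; split.
- by move=> n; apply: horn_UC; [exact: is_clauseset_chain | exact: horn_chain].
- exact: nvar_chain.
- exact: poly_time_chain.
(* The polynomial bound is refuted at an index 3m + 1 beyond [N], where [ell (F' n)] is at least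
   2^m. *)
case=> F' [pF eF [k [N bF]]]; have [m Nm lt] := exp_beats_poly k N.
have := leq_ltn_trans (bF _ Nm) lt.
by rewrite ltnNge ell_PC_chain.
Qed.
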